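(* Let $\Omega\subset\mathbb{R}^d$ be a rectangular domain, let $k\ge 1$, and for each mesh size $h$ let $\mathcal{T}_h$ be a uniform partition of $\Omega$ into square cells of diameter $h$. Let $m\le M$ with $m\in\mathbb{R}$ and $M\in\mathbb{R}\cup\{+\infty\}$. Let $f\in L^2(\Omega)$ satisfy $m\le f\le M$ on $\Omega$. For each $h$ let $f_h\in X_h$ satisfy $\int_\Omega f_h=\int_\Omega f$, let $\overline{w_h}$ be the minimizer of $$\min_{x_h}\ \|x_h-\overline{f_h}\|_{L^2(\Omega)}^2\quad\text{subject to}\quad \int_\Omega x_h=\int_\Omega f_h\ \ \text{and}\ \ m\le x_h\le M$$ over functions $x_h$ that are constant on each cell of $\mathcal{T}_h$, and define $$f_h^{\mathrm{lim}}=(f_h-\overline{f_h})+\overline{w_h}.$$ If there is a constant $C$ independent of $h$ with $\|f_h-f\|_{L^2(\Omega)}\le C h^{k+1}$ for all $h$, then there is a constant $C'$ independent of $h$ such that $\|f_h^{\mathrm{lim}}-f\|_{L^2(\Omega)}\le C' h^{k+1}$ for all $h$.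
   Context: $X_h=\{\chi_h\in L^2(\Omega):\chi_h|_{E}\in\mathbb{P}^k(E)\ \forall E\in\mathcal{T}_h\}$, where $\mathbb{P}^k(E)$ is the space of polynomials of degree at most $k$ on $E$. $\overline{f_h}$ is the piecewise constant function whose value on each cell $E\in\mathcal{T}_h$ is the cell average $\frac{1}{|E|}\int_E f_h$. The function $f$ plays the role of the exact solution (at a given time) and $f_h$ that of a discontinuous Galerkin approximation of it. When $M=+\infty$ the upper bound constraint is void. *)

(* Defs.v *)
From HB Require Import structures.
From mathcomp Require Import all_boot all_order all_algebra.
From mathcomp Require Import all_classical all_reals all_analysis.
(* The notations of mpoly clash with those of the analysis library; its
   canonical structures and coercions are needed for msize. *)
From mathcomp Require mpoly.
Import (canonicals,coercions) mpoly.

Set Implicit Arguments.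
Unset Strict Implicit.
Unset Printing Implicit Defensive.

Import Order.TTheory GRing.Theory Num.Theory.
Import numFieldNormedType.Exports.

Local Open Scope classical_set_scope.
Local Open Scope ring_scope.

(* measurableTypeR R is R with its Borel sigma-algebra; tuples over it carry
   the sigma-algebra generated by the coordinates, i.e., the Borel sets of
   R^d. *)
Definition Rd (R : realType) (d : nat) := d.-tuple (measurableTypeR R).

HB.instance Definition _ (R : realType) (d : nat) :=
  Measurable.copy (Rd R d) (d.-tuple (measurableTypeR R)).

Definition coord (R : realType) (d : nat) (x : Rd R d) (i : 'I_d) : R :=
  tnth x i.

Section lebesgue_Rd.
Context (R : realType).

Definition Rd_cons d (z : measurableTypeR R * Rd R d) : Rd R d.+1 :=
  [the d.+1.-tuple _ of z.1 :: z.2].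

Definition Rd_uncons d (x : Rd R d.+1) : measurableTypeR R * Rd R d :=
  (tnth x ord0, [tuple of behead x]).

Lemma measurable_Rd_cons d : measurable_fun [set: _] (@Rd_cons d).
Proof. exact: (measurable_cons measurable_fst measurable_snd). Qed.

Lemma measurable_Rd_uncons d : measurable_fun [set: _] (@Rd_uncons d).
Proof.
apply/measurable_fun_pairP; split; first exact: measurable_tnth.
exact: measurable_behead.
Qed.

Lemma Rd_consK d : cancel (@Rd_cons d) (@Rd_uncons d).
Proof. by case=> x t; congr pair; exact/val_inj. Qed.

Section step.
Context (d : nat) (mu : {sigma_finite_measure set (Rd R d) -> \bar R}).

Definition lebesgue_Rd_step : set (Rd R d.+1) -> \bar R :=
  pushforward (@lebesgue_measure R \x mu)%E (@Rd_cons d).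

Let step0 : lebesgue_Rd_step set0 = 0%E.
Proof. have mc := @measurable_Rd_cons d; exact: measure0. Qed.

Let step_ge0 A : (0 <= lebesgue_Rd_step A)%E.
Proof. have mc := @measurable_Rd_cons d; exact: measure_ge0. Qed.

Let step_sigma_additive : semi_sigma_additive lebesgue_Rd_step.
Proof.
have mc := @measurable_Rd_cons d; exact: measure_semi_sigma_additive.
Qed.

HB.instance Definition _ := isMeasure.Build _ _ _ lebesgue_Rd_step
  step0 step_ge0 step_sigma_additive.

Let sigma_finite_step : sigma_finite [set: Rd R d.+1] lebesgue_Rd_step.
Proof.
have /sigma_finiteP[F [TF ndF Foo]] :
  sigma_finite [set: measurableTypeR R] (@lebesgue_measure R).
  exact: sigma_finiteT.
have /sigma_finiteP[G [TG ndG Goo]] := sigma_finiteT mu.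
exists (fun n => @Rd_uncons d @^-1` (F n `*` G n)).
  rewrite -preimage_bigcup (_ : \bigcup_n _ = setT) ?preimage_setT//.
  apply/seteqP; split=> // -[x y] _.
  have [n _ Fnx] : (\bigcup_n F n) x by rewrite -TF.
  have [k _ Gky] : (\bigcup_n G n) y by rewrite -TG.
  exists (maxn n k) => //; split.
  - by move: x Fnx; exact/subsetPset/ndF/leq_maxl.
  - by move: y Gky; exact/subsetPset/ndG/leq_maxr.
move=> n; have [mF Fn] := Foo n; have [mG Gn] := Goo n; split.
  rewrite -[X in measurable X]setTI.
  by apply: measurable_Rd_uncons => //; exact: measurableX.
rewrite /lebesgue_Rd_step /pushforward.
rewrite (_ : _ @^-1` _ = F n `*` G n).
  by rewrite product_measure1E// lte_mul_pinfty// ge0_fin_numE.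
have uK z : (F n `*` G n) (Rd_uncons (Rd_cons z)) = (F n `*` G n) z.
  by rewrite Rd_consK.
by apply/funext => z; exact: uK.
Qed.

HB.instance Definition _ :=
  Measure_isSigmaFinite.Build _ _ _ lebesgue_Rd_step sigma_finite_step.

End step.

End lebesgue_Rd.

(* d-dimensional Lebesgue measure, as the iterated product of lebesgue_measure
   transported along R x R^d ~ R^(d+1). *)
Fixpoint lebesgue_Rd (R : realType) (d : nat) :
    {sigma_finite_measure set (Rd R d) -> \bar R} :=
  if d is d'.+1 then [the {sigma_finite_measure set (Rd R d'.+1) -> \bar R} of
                      lebesgue_Rd_step (lebesgue_Rd R d')]
  else [the {sigma_finite_measure set (Rd R 0) -> \bar R} of
        @dirac _ (Rd R 0) [tuple] R].

Section domain.
Context (R : realType) (d : nat).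
Implicit Types (a b : 'I_d -> R).

(* Half-open, so that the cells of a grid partition the domain exactly; L^2
   does not see the faces. *)
Definition box a b : set (Rd R d) :=
  [set x | forall i, a i <= coord x i < b i].

Lemma measurable_box a b : measurable (box a b).
Proof.
rewrite (_ : box a b =
    \bigcap_(i in [set: 'I_d])
      ((fun x : Rd R d => tnth x i) @^-1` [set` `[a i, b i[])).
  apply: fin_bigcap_measurable => [|i _]; first exact: finite_finset.
  rewrite -[X in measurable X]setTI.
  exact: (@measurable_tnth _ (measurableTypeR R) d i).
apply/seteqP; split=> x /= xab i; first by rewrite /= in_itv/=.
by have := xab i I; rewrite /= in_itv.
Qed.

End domain.

Lemma lebesgue_Rd_box (R : realType) (d : nat) (a b : 'I_d -> R) :
  (forall i, a i <= b i) ->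
  lebesgue_Rd R d (box a b) = (\prod_i (b i - a i))%:E.
Proof.
elim: d a b => [|d IH] a b ab.
  rewrite big_ord0 /= diracE (_ : _ \in _ = true)//.
  by apply/mem_set => -[].
rewrite /= /lebesgue_Rd_step /pushforward.
rewrite (_ : _ @^-1` _ = `[a ord0, b ord0[%classic `*`
    box (fun i => a (lift ord0 i)) (fun i => b (lift ord0 i))); last first.
  apply/seteqP; split=> -[x t] /=.
    move=> H; split => /=; first by rewrite in_itv/=; exact: (H ord0).
    move=> i; have := H (lift ord0 i).
    by rewrite /coord /Rd_cons/= tnthS.
  rewrite in_itv/= => -[H0 H1] i.
  have [j ->|->] := unliftP ord0 i; last exact: H0.
  by have := H1 j; rewrite /coord /Rd_cons/= tnthS.
have leb0 : @lebesgue_measure R [set` `[a ord0, b ord0[] =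
    (b ord0 - a ord0)%:E.
  rewrite lebesgue_measure_itv/= lte_fin; case: ltP => // ba.
  have -> : b ord0 = a ord0 by apply/eqP; rewrite eq_le ba ab.
  by rewrite subrr.
rewrite product_measure1E; last 2 first.
- exact: (measurable_itv `[a ord0, b ord0[).
- exact: measurable_box.
by rewrite IH// big_ord_recl EFinM; congr (_ * _)%E; exact: leb0.
Qed.

Section dg.
Context (R : realType) (d : nat).
Implicit Types (a b : 'I_d -> R) (T : set (set (Rd R d))) (f : Rd R d -> R).

(* Restriction to box a b. An element of L^2(box a b) is represented by a Borel
   function on R^d, e.g., its extension by 0, and every condition on it is
   imposed almost everywhere for this measure. *)
Definition lebesgue_on a b : set (Rd R d) -> \bar R :=
  mrestr (lebesgue_Rd R d) (measurable_box a b).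

HB.instance Definition _ a b := Measure.on (lebesgue_on a b).

Let lebesgue_on_fin a b : fin_num_fun (lebesgue_on a b).
Proof.
move=> A mA; rewrite ge0_fin_numE; last exact: measure_ge0.
have [ab|] := pselect (forall i, a i <= b i).
  rewrite /lebesgue_on /mrestr.
  apply: (@le_lt_trans _ _ (lebesgue_Rd R d (box a b))).
    apply: le_measure; rewrite ?inE//; first apply: measurableI => //.
    - exact: measurable_box.
    - exact: measurable_box.
  by rewrite lebesgue_Rd_box// ltry.
move=> /existsNP[i /negP]; rewrite -ltNge => bai.
rewrite /lebesgue_on /mrestr (_ : box a b = set0) ?setI0 ?measure0//.
apply/seteqP; split=> // x /(_ i) /andP[ax xb].
by have := lt_trans (le_lt_trans ax xb) bai; rewrite ltxx.
Qed.

HB.instance Definition _ a b :=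
  Measure_isFinite.Build _ _ _ (lebesgue_on a b) (@lebesgue_on_fin a b).

Definition edist (x y : Rd R d) : R :=
  Num.sqrt (\sum_i (coord x i - coord y i) ^+ 2).

Definition diam (A : set (Rd R d)) : R :=
  sup [set edist z.1 z.2 | z in A `*` A].

Definition grid_cell a (s : R) (j : 'I_d -> nat) : set (Rd R d) :=
  box (fun i => a i + (j i)%:R * s) (fun i => a i + (j i).+1%:R * s).

(* h is the diameter of the cells, not their side s. *)
Definition uniform_partition a b (h : R) T : Prop :=
  exists (s : R) (N : 'I_d -> nat),
  [/\ 0 < s,
      forall i, b i - a i = (N i)%:R * s,
      T = [set grid_cell a s j | j in [set j | forall i, (j i < N i)%N]] &
      forall E, T E -> diam E = h].

(* P^k(E) is the space of polynomials of total degree at most k; msize is one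
   more than the total degree. *)
Definition dg_space a b (k : nat) T : set (Rd R d -> R) :=
  [set f | f \in Lfun (lebesgue_on a b) 2%:E /\
    forall E, T E -> exists2 p : mpoly.mpoly d R, (mpoly.msize p <= k.+1)%N &
      {ae lebesgue_on a b, forall x, E x -> f x = mpoly.meval (coord x) p}].

Definition cellwise_constant a b T f : Prop :=
  forall E, T E -> exists c : R,
    {ae lebesgue_on a b, forall x, E x -> f x = c}.

Definition cell_average T f : Rd R d -> R := fun x =>
  \sum_(E \in T) (\int[lebesgue_Rd R d]_(y in E) f y)
                   / fine (lebesgue_Rd R d E) * \1_E x.

(* The upper bound is void when M = +oo. *)
Definition within_bounds a b (m : R) (M : \bar R) f : Prop :=
  {ae lebesgue_on a b, forall x, (m%:E <= (f x)%:E <= M)%E}.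

Definition limiter_feasible a b T (m : R) (M : \bar R) f : set (Rd R d -> R) :=
  [set x | [/\ x \in Lfun (lebesgue_on a b) 2%:E,
               cellwise_constant a b T x,
               \int[lebesgue_on a b]_y x y = \int[lebesgue_on a b]_y f y &
               within_bounds a b m M x]].

Definition limiter_objective a b T f (x : Rd R d -> R) : \bar R :=
  ('N[lebesgue_on a b]_2%:E[EFin \o (x \- cell_average T f)%R] ^+ 2)%E.

Definition limiter_minimizer a b T (m : R) (M : \bar R) f (w : Rd R d -> R)
    : Prop :=
  limiter_feasible a b T m M f w /\
  forall x, limiter_feasible a b T m M f x ->
    (limiter_objective a b T f w <= limiter_objective a b T f x)%E.

Definition limited T f (w : Rd R d -> R) : Rd R d -> R :=
  (f \- cell_average T f) \+ w.

End dg.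

(* Main.v *)
(** Write [P] for the cell average. Since [P] preserves the integral and the
    bounds, [P f] is feasible for the minimization problem, so that
    [||wh - P fh|| <= ||P f - P fh|| = ||P (f - fh)|| <= ||f - fh||], the last
    step because [P] is a contraction of L^2. The triangle inequality applied to
    [(fh - P fh + wh) - f = (fh - f) + (wh - P fh)] then gives the theorem with
    twice the constant. *)
Require Import Defs.
From HB Require Import structures.
From mathcomp Require Import all_boot all_order all_algebra.
From mathcomp Require Import all_classical all_reals all_analysis.
From mathcomp Require Import measurable_realfun ring.

Import Order.TTheory GRing.Theory Num.Theory.
Import numFieldNormedType.Exports.

Local Open Scope classical_set_scope.
Local Open Scope ring_scope.

(** * Integrals up to null sets and the L^2 norm *)

Lemma ae_le_Rintegral (disp : measure_display) (X : measurableType disp)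
    (R : realType) (mu : {measure set X -> \bar R}) (D : set X) (f g : X -> R) :
  measurable D ->
  mu.-integrable D (EFin \o f) -> mu.-integrable D (EFin \o g) ->
  {ae mu, forall x, f x <= g x} ->
  \int[mu]_(x in D) f x <= \int[mu]_(x in D) g x.
Proof.
move=> mD fi gi [N [mN N0 fgN]]; rewrite /Rintegral.
(* Deleting the null set [N] changes neither integral, and the inequality holds at every point of
   what is left. *)
have mDN : measurable (D `\` N) by exact: measurableD.
rewrite (negligible_integral mN mD fi N0) (negligible_integral mN mD gi N0).
apply: le_Rintegral => //.
- by apply: integrableS fi => //; exact: subDsetl.
- by apply: integrableS gi => //; exact: subDsetl.
- by move=> x [_ Nx]; apply: contrapT => fgx; exact/Nx/fgN.
Qed.

Lemma Lnorm2E (disp : measure_display) (X : measurableType disp)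
    (R : realType) (mu : {measure set X -> \bar R}) (g : X -> R) :
  ('N[mu]_2%:E[EFin \o g] = (\int[mu]_x (g x ^+ 2)%:E) `^ 2^-1)%E.
Proof.
rewrite unlock; congr (_ `^ _)%E; apply: eq_integral => x _.
by rewrite /= powR_mulrn// real_normK ?num_real.
Qed.

(** * Averaging over finitely many cells in a finite measure space *)

Section cell_projection.
Context {disp : measure_display} {X : measurableType disp} {R : realType}.
Context (mu : {finite_measure set X -> \bar R}).
Context {I : finType} (F : I -> set X).
Hypothesis mF : forall i, measurable (F i).
Hypothesis F_triv : trivIset setT F.
(** Covering up to a null set is the right notion here: the cells will fill a box of R^d, and [mu]
    will be a measure on all of R^d that vanishes off that box. *)
Hypothesis F_cover : mu (~` \bigcup_i F i) = 0%E.
Hypothesis F_gt0 : forall i, (0 < mu (F i))%E.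
Implicit Types (f g : X -> R).

Definition mean (A : set X) g : R := (\int[mu]_(y in A) g y) / fine (mu A).

(** On L^2 this is the orthogonal projection onto the cellwise constant functions, that is, the
    conditional expectation given the cells. Off the cells its value is 0. *)
Definition cell_projection g : X -> R :=
  fun x => \sum_i mean (F i) g * \1_(F i) x.

Let Lfun2_integrable g : g \in Lfun mu 2%:E ->
  forall A, measurable A -> mu.-integrable A (EFin \o g).
Proof.
move=> g2 A mA; apply: (@integrableS _ _ _ _ setT) => //.
by apply/Lfun1_integrable; apply: Lfun_subset12 => //; exact: fin_num_measure.
Qed.

Let fine_gt0 i : 0 < fine (mu (F i)).
Proof. by rewrite fine_gt0// F_gt0 -ge0_fin_numE// fin_num_measure. Qed.

Lemma cell_projectionE g i x : F i x -> cell_projection g x = mean (F i) g.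
Proof.
move=> Fix; rewrite /cell_projection (bigD1 i)//= indicE mem_set// mulr1.
rewrite big1 ?addr0// => j ji; rewrite indicE memNset ?mulr0// => Fjx.
by case/eqP: ji; apply: F_triv => //; exists x.
Qed.

(** The uncovered set is null and can be deleted; what remains is a finite disjoint union. *)
Lemma Rintegral_cells g : mu.-integrable setT (EFin \o g) ->
  \int[mu]_x g x = \sum_i \int[mu]_(x in F i) g x.
Proof.
move=> gi; have mU : measurable (\bigcup_i F i).
  by apply: fin_bigcup_measurable => //; exact: finite_finset.
have UE : \bigcup_i F i = \big[setU/set0]_(i <- index_enum I) F i.
  rewrite -bigcup_seq; congr bigcup; apply/seteqP; split=> // i _ /=.
  by rewrite mem_index_enum.
apply: EFin_inj; rewrite -sumEFin /Rintegral fineK; last exact: integrable_fin_num.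
rewrite (@negligible_integral _ _ _ _ setT (~` \bigcup_i F i))//; last exact: measurableC.
rewrite setTD setCK UE integral_bigsetU_EFin//.
- apply: eq_bigr => i _; rewrite fineK//; apply: integrable_fin_num => //.
  exact: (@integrableS _ _ _ _ setT).
- exact: index_enum_uniq.
- exact: sub_trivIset F_triv.
- by apply: (measurable_int mu); rewrite -UE; exact: (@integrableS _ _ _ _ setT).
Qed.

(** Whatever real numbers the means are, this is a finite linear combination of indicators of sets
    of finite measure. *)
Lemma Lfun_cell_projection g : cell_projection g \in Lfun mu 2%:E.
Proof.
rewrite (_ : cell_projection g = \sum_i (mean (F i) g \o* \1_(F i))); last first.
  by apply/funext => x; rewrite fct_sumE; apply: eq_bigr => i _; rewrite /= mulrC.
have l2 : (1 <= 2%:E :> \bar R)%E by rewrite lee_fin ler1n.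
apply: (big_ind (fun f => f \in Lfun mu 2%:E)).
- exact: (Lfun_addr_closed mu l2).1.
- exact: (Lfun_addr_closed mu l2).2.
- move=> i _; apply: Lfun_scale; first by rewrite ler1n.
  rewrite inE; apply/andP; split; rewrite inE/=.
    exact: measurable_indic.
  rewrite /finite_norm Lnorm2E poweR_lty//.
  rewrite (eq_integral (fun x => (\1_(F i) x)%:E)).
    by rewrite integral_indic// setIT -ge0_fin_numE// fin_num_measure.
  by move=> x _; rewrite indicE -natrX; case: (_ \in _).
Qed.

Lemma Lfun2_integrable_sqrS g A : g \in Lfun mu 2%:E -> measurable A ->
  mu.-integrable A (EFin \o (fun x => g x ^+ 2)).
Proof.
move=> g2 mA; apply: (@integrableS _ _ _ _ setT) => //.
exact: Lfun2_integrable_sqr.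
Qed.

Lemma mean_mulE g i : mean (F i) g * fine (mu (F i)) = \int[mu]_(x in F i) g x.
Proof. by rewrite /mean divfK// gt_eqF. Qed.

(** On each cell both integrals equal the mean times the measure of the cell. *)
Lemma Rintegral_cell_projection g : g \in Lfun mu 2%:E ->
  \int[mu]_x cell_projection g x = \int[mu]_x g x.
Proof.
move=> g2; rewrite !Rintegral_cells; first last.
- exact: Lfun2_integrable (Lfun_cell_projection g) _ _.
- exact: Lfun2_integrable.
apply: eq_bigr => i _.
rewrite (@eq_Rintegral _ _ _ _ _ (cst (mean (F i) g))); last first.
  by move=> x /set_mem; exact: cell_projectionE.
by rewrite Rintegral_cst// mean_mulE.
Qed.

(* Integrating [g^2 >= 2 c g - c^2] over a cell, with [c] the mean of [g],
   gives Jensen's inequality on that cell. *)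
Lemma Rintegral_sqr_cell_projection_le g : g \in Lfun mu 2%:E ->
  \int[mu]_x cell_projection g x ^+ 2 <= \int[mu]_x g x ^+ 2.
Proof.
move=> g2; rewrite !Rintegral_cells; first last.
- exact: Lfun2_integrable_sqrS (Lfun_cell_projection g) _.
- exact: Lfun2_integrable_sqrS.
apply: ler_sum => i _; set c := mean (F i) g.
rewrite (@eq_Rintegral _ _ _ _ _ (cst (c ^+ 2))); last first.
  by move=> x /set_mem Fix; rewrite (cell_projectionE _ _ _ Fix).
have ic r : mu.-integrable (F i) (EFin \o (fun=> r)).
  exact: finite_measure_integrable_cst.
have ig := Lfun2_integrable g g2 (F i) (mF i).
have icg : mu.-integrable (F i) (EFin \o (fun x => 2 * c * g x)).
  exact: (integrableZl (mF i) (2 * c) ig).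
rewrite [leLHS](_ : _ = \int[mu]_(x in F i) (2 * c * g x - c ^+ 2)); last first.
  rewrite RintegralB// RintegralZl// -(mean_mulE g) -/c !Rintegral_cst//.
  by ring.
apply: le_Rintegral => //.
- exact: (integrableB (mF i) icg (ic (c ^+ 2))).
- exact: Lfun2_integrable_sqrS.
- move=> x _; rewrite -subr_ge0 (_ : _ - _ = (g x - c) ^+ 2) ?sqr_ge0//.
  by ring.
Qed.

(** The square root is monotone, and the integrals of the squares are finite, so the comparison of
    their real values carries over to the norms. *)
Lemma Lnorm_cell_projection_le g : g \in Lfun mu 2%:E ->
  ('N[mu]_2%:E[EFin \o cell_projection g] <= 'N[mu]_2%:E[EFin \o g])%E.
Proof.
move=> g2; rewrite !Lnorm2E.
have i2 f : f \in Lfun mu 2%:E -> (\int[mu]_x (f x ^+ 2)%:E = (\int[mu]_x f x ^+ 2)%:E)%E.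
  by move=> f2; rewrite fineK//; apply: integrable_fin_num => //; exact: Lfun2_integrable_sqrS.
rewrite !i2//; last exact: Lfun_cell_projection.
rewrite gt0_ler_poweR//.
- by rewrite in_itv/= leey lee_fin Rintegral_ge0// => x _; exact: sqr_ge0.
- by rewrite in_itv/= leey lee_fin Rintegral_ge0// => x _; exact: sqr_ge0.
- by rewrite lee_fin Rintegral_sqr_cell_projection_le.
Qed.

Lemma cell_projectionB f g : f \in Lfun mu 2%:E -> g \in Lfun mu 2%:E ->
  cell_projection f \- cell_projection g = cell_projection (f \- g).
Proof.
move=> f2 g2; apply/funext => x; rewrite /cell_projection /= -sumrB.
apply: eq_bigr => i _; rewrite -mulrBl /mean RintegralB ?mulrBl//.
- exact: Lfun2_integrable.
- exact: Lfun2_integrable.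
Qed.

(** Integrating the bounds over a cell and dividing by its positive measure bounds the mean. *)
Lemma cell_projection_bounds g (m : R) (M : \bar R) : g \in Lfun mu 2%:E ->
  {ae mu, forall x, m%:E <= (g x)%:E <= M}%E ->
  {ae mu, forall x, m%:E <= (cell_projection g x)%:E <= M}%E.
Proof.
(* The null set where [g] leaves the bounds does not affect the means, so only the uncovered set is
   exceptional. *)
move=> g2 gmM; exists (~` \bigcup_i F i); split=> //.
  by apply/measurableC/fin_bigcup_measurable => //; exact: finite_finset.
apply: subsetC => x [i _ Fix]; rewrite /= (cell_projectionE _ _ _ Fix).
have ic r : mu.-integrable (F i) (EFin \o (fun=> r)).
  exact: finite_measure_integrable_cst.
have ig := Lfun2_integrable g g2 (F i) (mF i).
apply/andP; split.
  rewrite lee_fin /mean ler_pdivlMr// -Rintegral_cst//.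
  by apply: ae_le_Rintegral => //; apply: filterS gmM => y /andP[].
case: M gmM => [M| |] gmM; last 2 first.
- by rewrite leey.
(* For [M = -oo] the bound fails at every point, so a cell of positive measure would lie in a null
   set. *)
- have [N [mN N0 gN]] := gmM.
  have : (mu (F i) <= mu N)%E.
    by apply: le_measure; rewrite ?inE// => y _; apply: gN => /andP[].
  by rewrite N0 leNgt F_gt0.
rewrite lee_fin /mean ler_pdivrMr// -Rintegral_cst//.
by apply: ae_le_Rintegral => //; apply: filterS gmM => y /andP[].
Qed.

End cell_projection.

(** * The uniform grid as a finite family of disjoint cells *)

Section grid.
Context {R : realType} {d : nat} {a b : 'I_d -> R} {s : R} {N : 'I_d -> nat}.
Hypothesis s0 : 0 < s.
Hypothesis bN : forall i, b i - a i = (N i)%:R * s.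

(** A finite type, as [cell_projection] requires, replacing the bounded functions to [nat] that
    index the cells of [uniform_partition]. *)
Definition grid_index := {dffun forall i : 'I_d, 'I_(N i)}.

Definition indexed_cell (j : grid_index) : set (Rd R d) :=
  grid_cell a s (fun i => j i).

Lemma grid_cell_indexed (j : 'I_d -> nat) (jN : forall i, (j i < N i)%N) :
  grid_cell a s j = indexed_cell [ffun i => Ordinal (jN i)].
Proof.
by rewrite /indexed_cell; congr grid_cell; apply/funext => i; rewrite ffunE.
Qed.

Lemma measurable_indexed_cell j : measurable (indexed_cell j).
Proof. exact: measurable_box. Qed.

Lemma indexed_cell_sub j : indexed_cell j `<=` box a b.
Proof.
move=> x jx i; have /andP[ax xb] := jx i; apply/andP; split.
  by apply: le_trans ax; rewrite lerDl mulr_ge0// ltW.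
(* The upper face has index [(j i).+1], which is at most [N i] because [j i < N i]. *)
apply: (lt_le_trans xb); rewrite -lerBrDl bN ler_pM2r// ler_nat.
exact: ltn_ord.
Qed.

(** As cells are half-open, a common point of cells [j] and [l] gives [j i < (l i).+1], so
    [j i <= l i]; equality follows by symmetry. *)
Lemma trivIset_indexed_cell : trivIset setT indexed_cell.
Proof.
move=> j l _ _ [x [jx lx]]; apply/ffunP => i; apply/val_inj => /=.
have le_of (j' l' : grid_index) : indexed_cell j' x -> indexed_cell l' x ->
    (j' i <= l' i)%N.
  move=> /(_ i)/andP[jx' _] /(_ i)/andP[_ xl'].
  have := le_lt_trans jx' xl'; rewrite ltrD2l ltr_pM2r// ltr_nat.
  by rewrite ltnS.
by apply/eqP; rewrite eqn_leq !le_of.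
Qed.

Lemma bigcup_indexed_cell : \bigcup_j indexed_cell j = box a b.
Proof.
apply/seteqP; split=> [x [j _]|x abx]; first exact: indexed_cell_sub.
(* The cell containing [x] has the integer part of [q] as its index; the strict inequality at [b i]
   keeps it below [N i]. *)
pose q i := (Defs.coord x i - a i) / s.
have q0 i : 0 <= q i.
  by apply: divr_ge0; [rewrite subr_ge0; case/andP: (abx i)|exact: ltW].
have qN i : (Num.truncn (q i) < N i)%N.
  rewrite -(ltr_nat R); have /andP[qi _] := truncn_itv (q0 i).
  apply: (le_lt_trans qi); rewrite ltr_pdivrMr// -bN ltrD2r.
  by case/andP: (abx i).
exists [ffun i => Ordinal (qN i)] => // i; rewrite ffunE /=.
have /andP[ql qu] := truncn_itv (q0 i).
rewrite -lerBrDl -ler_pdivlMr// ql/=.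
by rewrite -ltrBlDl -ltr_pdivrMr.
Qed.

Lemma lebesgue_on_indexed_cell j :
  lebesgue_on a b (indexed_cell j) = lebesgue_Rd R d (indexed_cell j).
Proof.
by rewrite /lebesgue_on /mrestr setIidl//; exact: indexed_cell_sub.
Qed.

Lemma lebesgue_on_indexed_cell_gt0 j :
  (0 < lebesgue_on a b (indexed_cell j))%E.
Proof.
rewrite lebesgue_on_indexed_cell lebesgue_Rd_box; last first.
  by move=> i; rewrite lerD2l ler_pM2r// ler_nat.
rewrite lte_fin; apply: prodr_gt0 => i _.
by rewrite opprD addrACA subrr add0r -mulrBl -natrB// subSnn mul1r.
Qed.

Lemma lebesgue_on_setC_cells :
  lebesgue_on a b (~` \bigcup_j indexed_cell j) = 0%E.
Proof.
by rewrite bigcup_indexed_cell /lebesgue_on /mrestr setICl measure0.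
Qed.

(** Two changes are made: the sum over a set of cells becomes a sum over indices, and Lebesgue
    measure becomes its restriction to the box. *)
Lemma cell_averageE (g : Rd R d -> R) :
  cell_average [set grid_cell a s j | j in [set j | forall i, (j i < N i)%N]] g
  = cell_projection (lebesgue_on a b) indexed_cell g.
Proof.
rewrite (_ : [set _ | _ in _] = [set indexed_cell j | j in setT]); last first.
  apply/seteqP; split=> [_ [j jN <-]|_ [j _ <-]]; last first.
    by exists (fun i => val (j i)) => // i; exact: ltn_ord.
  by exists [ffun i => Ordinal (jN i)] => //; rewrite grid_cell_indexed.
apply/funext => x; rewrite /cell_average.
(* Equal cells meet, since positive measure makes a cell nonempty; disjointness then forces equal
   indices. *)
have inj : {in [set: grid_index] &, injective indexed_cell}.
  move=> j l _ _ jl; apply: trivIset_indexed_cell => //; rewrite -jl setIid.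
  apply/set0P/negP => /eqP j0.
  by have := lebesgue_on_indexed_cell_gt0 j; rewrite j0 measure0 ltxx.
rewrite fsbig_image//.
rewrite (fsbigE (index_enum grid_index))//; first last.
- by move=> j _; rewrite mem_index_enum.
- exact: index_enum_uniq.
under eq_bigl do rewrite in_setT.
apply: eq_bigr => j _; congr (_ / fine _ * _); last first.
  exact/esym/lebesgue_on_indexed_cell.
(* The two measures agree on every measurable subset of a cell, since the cell lies in the box. *)
congr fine; apply: eq_measure_integral => A mA Aj.
rewrite -[RHS]/(lebesgue_Rd R d (A `&` box a b)) setIidl//.
by apply: subset_trans Aj _; exact: indexed_cell_sub.
Qed.

End grid.

(* H is the set of mesh sizes. *)
Theorem mainTheorem2 (R : realType) (d : nat) (a b : 'I_d -> R) (k : nat)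
    (H : set R) (T : R -> set (set (Rd R d))) (m : R) (M : \bar R)
    (f : Rd R d -> R) (fh wh : R -> Rd R d -> R) :
  (0 < d)%N ->
  (forall i, a i < b i) ->
  (0 < k)%N ->
  (forall h, H h -> uniform_partition a b h (T h)) ->
  (m%:E <= M)%E ->
  f \in Lfun (lebesgue_on a b) 2%:E ->
  within_bounds a b m M f ->
  (forall h, H h -> dg_space a b k (T h) (fh h)) ->
  (forall h, H h ->
     \int[lebesgue_on a b]_x fh h x = \int[lebesgue_on a b]_x f x) ->
  (forall h, H h -> limiter_minimizer a b (T h) m M (fh h) (wh h)) ->
  (exists C : R, forall h, H h ->
     ('N[lebesgue_on a b]_2%:E[EFin \o (fh h \- f)%R]
        <= (C * h ^+ k.+1)%:E)%E) ->
  exists C' : R, forall h, H h ->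
    ('N[lebesgue_on a b]_2%:E[EFin \o (limited (T h) (fh h) (wh h) \- f)%R]
       <= (C' * h ^+ k.+1)%:E)%E.
Proof.
move=> _ _ _ HT _ f2 fmM fhX fhf wmin [C fhC].
exists (C + C) => h Hh; have fhCh := fhC _ Hh.
have [s [N [s0 bN TE _]]] := HT _ Hh.
have [fh2 _] := fhX _ Hh; have [[w2 _ _ _] wle] := wmin _ Hh.
set mu := lebesgue_on a b in f2 fh2 w2 fhCh *.
set P := cell_projection mu (indexed_cell (a := a) (s := s) (N := N)).
have avgE g : cell_average (T h) g = P g by rewrite TE (cell_averageE s0 bN).
have mF := measurable_indexed_cell (a := a) (s := s) (N := N).
have trivF := trivIset_indexed_cell (a := a) (N := N) s0.
have coverF := lebesgue_on_setC_cells s0 bN.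
have gt0F := lebesgue_on_indexed_cell_gt0 s0 bN.
have P2 g : P g \in Lfun mu 2%:E by exact: Lfun_cell_projection.
have mLfun g : g \in Lfun mu 2%:E -> measurable_fun setT g.
  by rewrite inE => /andP[] /[!inE].
have l2 : (1 <= 2%:E :> \bar R)%E by rewrite lee_fin ler1n.
have fmh2 : f \- fh h \in Lfun mu 2%:E.
  exact: ((Lfun_addr_closed mu l2).2 _ _ f2 (Lfun_oppr_closed fh2)).
have Pf_feasible : limiter_feasible a b (T h) m M (fh h) (P f).
  split.
  - exact: P2.
  - move=> E; rewrite TE => -[j jN <-]; exists (mean mu (grid_cell a s j) f).
    apply: aeW => x jx.
    have jE := grid_cell_indexed (a := a) (s := s) _ jN.
    by move: jx; rewrite jE; exact: cell_projectionE.
  (* The constraint prescribes the integral of [fh h], which equals that of [f], and averaging [f]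
     preserves the latter. *)
  - rewrite fhf//; exact: Rintegral_cell_projection.
  - exact: cell_projection_bounds.
have wP : ('N[mu]_2%:E[EFin \o (wh h \- P (fh h))%R] <= (C * h ^+ k.+1)%:E)%E.
  have := wle _ Pf_feasible; rewrite /limiter_objective avgE.
  (* The objective is a squared norm; nonnegativity allows the squares to be dropped. *)
  move=> /(lee_sqrE (Lnorm_ge0 _ _ _)) /le_trans; apply.
  rewrite /P cell_projectionB//.
  apply: (le_trans (Lnorm_cell_projection_le _ _ _ _ _ _ _ fmh2)) => //.
  apply: le_trans fhCh.
  (* The contraction leaves [f - fh], while the assumed estimate concerns [fh - f]. *)
  rewrite (_ : EFin \o (f \- fh h)%R = \- (EFin \o (fh h \- f)%R))%E ?oppe_Lnorm//.
  by apply/funext => x; rewrite -[RHS]/((- (fh h x - f x))%:E) opprB.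
rewrite /limited avgE.
rewrite (_ : _ \- f = (fh h \- f) \+ (wh h \- P (fh h))); last first.
  by apply/funext => x /=; ring.
apply: (le_trans (minkowski_EFin _ _ _ _)).
- by apply: measurable_funB; exact: mLfun.
- by apply: measurable_funB; exact: mLfun.
- by rewrite ler1n.
- by rewrite mulrDl [leRHS]EFinD; exact: leeD.
Qed.
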